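(* Let $z\in\mathbb{N}$ and $\mathcal{Z}=\{1,\dots,z\}$. (i) Let $\mathbf{Z}$ be a $z\times z$ (real or complex) matrix. Then there exist $\eta>0$ and $j,k\in\mathcal{Z}$ such that $i\mapsto\left|[\mathbf{Z}^i]_{j,k}\right|^2$ is asymptotically and periodically lower bounded by $i\mapsto\eta\,(\rho(\mathbf{Z}))^{2i}$, with a period that is a positive integer no larger than the number of (distinct) eigenvalues of $\mathbf{Z}$ having the maximum magnitude $\rho(\mathbf{Z})$. (ii) Let $\mathbf{Z}$ and $\mathbf{Q}$ be $z\times z$ matrices such that $\mathbf{Q}$ is symmetric positive semidefinite and $(\mathbf{Z},\sqrt{\mathbf{Q}})$ is controllable. Then there exist $\eta>0$ and $j,k\in\mathcal{Z}$ such that $i\mapsto\left|[\mathbf{Z}^i\sqrt{\mathbf{Q}}]_{j,k}\right|^2$ is asymptotically and periodically lower bounded by $i\mapsto\eta\,(\rho(\mathbf{Z}))^{2i}$, with a period that is a positive integer no larger than the number of (distinct) eigenvalues of $\mathbf{Z}$ having the maximum magnitude $\rho(\mathbf{Z})$.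
   Context: $\rho(\cdot)$ is the spectral radius; $[\cdot]_{j,k}$ is the $(j,k)$ entry; $\sqrt{\mathbf{Q}}$ is the symmetric positive semidefinite square root of $\mathbf{Q}$. Controllability of $(\mathbf{Z},\sqrt{\mathbf{Q}})$ means that $[\sqrt{\mathbf{Q}},\mathbf{Z}\sqrt{\mathbf{Q}},\dots,\mathbf{Z}^{z-1}\sqrt{\mathbf{Q}}]$ has full rank $z$. Definition: a function $r(\cdot)$ on the positive integers is asymptotically and periodically lower bounded by $\underline{r}(\cdot)$ with period $l\in\mathbb{N}$ if there exists $N\in\mathbb{N}$ such that $\max\{r(i),r(i+1),\dots,r(i+l-1)\}\ge\underline{r}(i)$ for all $i\ge N$. *)

(* Defs.v *)
(* [R : realType] is the field of real numbers and [R[i]] the field of complex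
   numbers. *)
From HB Require Import structures.
From mathcomp Require Export all_boot all_order all_algebra.
From mathcomp Require Export reals.
From mathcomp Require Export complex.

Set Implicit Arguments.
Unset Strict Implicit.
Unset Printing Implicit Defensive.

Import Order.TTheory GRing.Theory Num.Theory.

Local Open Scope ring_scope.

(* The modulus |x| of a complex number as an element of [R] (the generic norm
   [`|x|] of [R[i]] is [R[i]]-valued). *)
Definition cmod (R : realType) (x : R[i]) : R := ComplexField.Normc.normc x.

(* The duplicate-free list of the complex eigenvalues of [A]. *)
Definition eigenvalues (R : realType) (z : nat) (A : 'M[R[i]]_z) : seq R[i] :=
  undup (sval (closed_field_poly_normal (char_poly A))).

Lemma eigenvalues_uniq (R : realType) (z : nat) (A : 'M[R[i]]_z) :
  uniq (eigenvalues A).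
Proof. exact: undup_uniq. Qed.

Lemma mem_eigenvalues (R : realType) (z : nat) (A : 'M[R[i]]_z) (a : R[i]) :
  (a \in eigenvalues A) = eigenvalue A a.
Proof.
rewrite eigenvalue_root_char mem_undup.
case: (closed_field_poly_normal (char_poly A)) => s /= {1}->.
by rewrite (monicP (char_poly_monic A)) scale1r root_prod_XsubC.
Qed.

(* The default value 0 of the maximum matters only when [z = 0]. *)
Definition spectral_radius (R : realType) (z : nat) (A : 'M[R[i]]_z) : R :=
  \big[Num.max/0]_(a <- eigenvalues A) cmod a.

Definition num_peripheral_eigenvalues (R : realType) (z : nat)
    (A : 'M[R[i]]_z) : nat :=
  size [seq a <- eigenvalues A | cmod a == spectral_radius A].

(* [r] and [rlow] stand for functions on the positive integers: their value at
   0 is irrelevant since the threshold [N] is positive. For [0 < l], the default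
   value [r i] of the maximum is its term at [t = 0], hence is harmless. *)
Definition asymp_periodically_lower_bounded (R : realType)
    (r rlow : nat -> R) (l : nat) : Prop :=
  exists2 N : nat, (0 < N)%N &
    forall i : nat, (N <= i)%N ->
      rlow i <= \big[Num.max/r i]_(t < l) r (i + t)%N.

Definition sym_psd (R : realType) (z : nat) (Q : 'M[R]_z) : Prop :=
  Q^T = Q /\ forall x : 'cV[R]_z, 0 <= (x^T *m Q *m x) 0 0.

(* [S] is the (unique) symmetric positive semidefinite square root of [Q]. *)
Definition is_psd_sqrt (R : realType) (z : nat) (Q S : 'M[R]_z) : Prop :=
  sym_psd S /\ S *m S = Q.

Definition complex_mx (R : realType) (m n : nat) (A : 'M[R]_(m, n)) :
  'M[R[i]]_(m, n) := map_mx (real_complex R) A.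

Definition controllability_mx (R : realType) (z : nat) (Z B : 'M[R[i]]_z) :
  'M[R[i]]_(z, \sum_(k < z) z) := \mxrow_(k < z) (Z ^+ k *m B).

Definition controllable (R : realType) (z : nat) (Z B : 'M[R[i]]_z) : Prop :=
  \rank (controllability_mx Z B) = z.

(* Main.v *)
(* Generalized eigenspaces give
   [Z^i B = sum_mu sum_s C(i, s) mu^(i-s) E_mu (Z - mu)^s B] with
   [sum_mu E_mu = 1] and [E_mu (Z - mu)^z = 0]. If [la] is peripheral then
   [E_la != 0], so controllability forces [E_la (Z - la)^s B] to have a nonzero
   entry [(j, k)] for some [s]. Let [d] be the largest such [s] over all the
   peripheral eigenvalues, for this [(j, k)]. After division by
   [C(i, d) rho^i], the entry is an exponential sum over the [l] peripheral
   eigenvalues up to an error [O(1/i)], and such a sum is bounded below on every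
   window of length [l]: the coefficients of the polynomial vanishing at all
   peripheral eigenvalues but one combine [l] consecutive values into a single
   geometric term. Part (i) is the case [B = 1]. *)
Require Import Defs.
From mathcomp Require Import ring lra zify.
Import Order.TTheory GRing.Theory Num.Theory.
Local Open Scope ring_scope.

(** * The real-valued modulus of complex numbers *)

Section Cmod.
Variable R : realType.
Implicit Types x y : R[i].

Lemma normE_cmod x : `|x| = (cmod x)%:C%C.
Proof. by rewrite normc_def; case: x. Qed.

Lemma cmod_ge0 x : 0 <= cmod x.
Proof. by case: x => a b; exact: sqrtr_ge0. Qed.

Lemma cmod_eq0 x : (cmod x == 0) = (x == 0).
Proof. by rewrite -(inj_eq (@complexI R)) -normE_cmod normr_eq0. Qed.

Lemma cmod_gt0 x : (0 < cmod x) = (x != 0).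
Proof. by rewrite lt_def cmod_eq0 cmod_ge0 andbT. Qed.

Lemma cmod0 : cmod (0 : R[i]) = 0.
Proof. by apply/eqP; rewrite cmod_eq0. Qed.

Lemma cmodM x y : cmod (x * y) = cmod x * cmod y.
Proof. exact: ComplexField.Normc.normcM. Qed.

Lemma cmodX x n : cmod (x ^+ n) = cmod x ^+ n.
Proof. by apply: (@complexI R); rewrite rmorphXn /= -!normE_cmod normrX. Qed.

Lemma cmod_nat n : cmod (n%:R : R[i]) = n%:R.
Proof. by apply: (@complexI R); rewrite rmorph_nat -normE_cmod normr_nat. Qed.

Lemma cmodN x : cmod (- x) = cmod x.
Proof. by apply: (@complexI R); rewrite -!normE_cmod normrN. Qed.

Lemma ler_cmodD x y : cmod (x + y) <= cmod x + cmod y.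
Proof. by rewrite -lecR rmorphD /= -!normE_cmod ler_normD. Qed.

Lemma ler_cmod_sum (I : Type) (r : seq I) (P : pred I) (f : I -> R[i]) :
  cmod (\sum_(i <- r | P i) f i) <= \sum_(i <- r | P i) cmod (f i).
Proof.
elim/big_ind2: _ => [|x a y b xa yb|//]; first by rewrite cmod0.
exact: le_trans (ler_cmodD _ _) (lerD xa yb).
Qed.

End Cmod.

(** * Growth of binomial coefficients in the upper index *)

Lemma bin_mul_index_le s i : (2 * s.+1 <= i)%N ->
  ('C(i, s) * i <= 2 * s.+1 * 'C(i, s.+1))%N.
Proof.
move=> si; have := mul_bin_left i s; move: 'C(i, s) 'C(i, s.+1) => a b.
by move=> e; rewrite -mulnA e mulnA mulnC leq_mul2r; lia.
Qed.

Lemma leq_bin_below_half s d i : (s <= d)%N -> (2 * d <= i)%N ->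
  ('C(i, s) <= 'C(i, d))%N.
Proof.
move=> sd; rewrite -(subnKC sd); elim: (d - s)%N => [|k IHk] ki.
  by rewrite addn0.
apply: leq_trans (IHk _) _; first by lia.
have := mul_bin_left i (s + k); rewrite addnS => e.
rewrite -(leq_pmul2l (ltn0Sn (s + k))) e.
have := leq_mul (_ : (s + k).+1 <= i - (s + k))%N (leqnn 'C(i, s + k)).
by apply; lia.
Qed.

Lemma bin_mul_index_lt s d i : (s < d)%N -> (2 * d <= i)%N ->
  ('C(i, s) * i <= 2 * d * 'C(i, d))%N.
Proof.
move=> sd di; apply: leq_trans (bin_mul_index_le s i _) _; first by lia.
by apply: leq_mul; [lia | exact: leq_bin_below_half].
Qed.

(** A binomial coefficient of higher order absorbs the factor [i]. With [t] between [th] and 1 and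
    [t^-1 = 1 + h], a single term of the expansion of [(1 + h) ^+ i] bounds
    ['C(i, s.+1) * t ^+ i]. *)
Lemma bin_geometric_decay (R : realFieldType) (th : R) s :
  0 <= th -> th < 1 ->
  exists K : R, forall i, (2 * s.+1 <= i)%N ->
    'C(i, s)%:R * th ^+ (i - s) * i%:R <= K.
Proof.
move=> th0 th1.
(* The midpoint stays positive, hence invertible, even when [th = 0]. *)
pose t := (1 + th) / 2; have t0 : 0 < t by rewrite /t; lra.
have tht : th <= t by rewrite /t; lra.
have t1 : t < 1 by rewrite /t; lra.
pose h := t^-1 - 1; have h0 : 0 < h by rewrite subr_gt0 invf_gt1.
exists ((2 * s.+1)%:R / h ^+ s.+1 / t ^+ s) => i si.
have le1 : 'C(i, s.+1)%:R * h ^+ s.+1 <= t ^- i.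
  have -> : t ^- i = (1 + h) ^+ i by rewrite /h addrC subrK exprVn.
  have si' : (s.+1 < i.+1)%N by lia.
  rewrite (exprDn 1 h i) (bigD1 (Ordinal si')) //= expr1n mul1r -[h ^+ _ *+ _]mulr_natl.
  by rewrite lerDl sumr_ge0 // => k _; rewrite mulrn_wge0 // expr1n mul1r exprn_ge0 // ltW.
have le2 : ('C(i, s) * i)%:R <= (2 * s.+1 * 'C(i, s.+1))%:R :> R.
  by rewrite ler_nat bin_mul_index_le.
rewrite ler_pdivlMr ?exprn_gt0 //.
apply: (@le_trans _ _ (('C(i, s) * i)%:R * t ^+ i)).
  have -> : t ^+ i = t ^+ (i - s) * t ^+ s by rewrite -exprD subnK //; lia.
  rewrite natrM mulrA ler_wpM2r ?exprn_ge0 ?(ltW t0) // mulrAC ler_wpM2l //.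
    by rewrite mulr_ge0.
  by rewrite lerXn2r // nnegrE ltW.
rewrite ler_pdivlMr ?exprn_gt0 // -mulrA.
have th_ge0 : 0 <= t ^+ i * h ^+ s.+1 by rewrite mulr_ge0 ?exprn_ge0 // ltW.
apply: le_trans (ler_wpM2r th_ge0 le2) _.
rewrite natrM -mulrA ler_piMr // mulrCA -mulrC.
by rewrite -ler_pdivlMr ?exprn_gt0 // div1r.
Qed.

(** * Exponential sums on windows, and negligible terms *)

Section Asymptotics.
Variable R : realType.

(** Were every term of a window small, the triangle inequality would make the combination with the
    coefficients of [q] smaller than the geometric term in [la] that it equals. The constant depends
    only on [q], [gam], [la] and [rho], hence is uniform in [i]. *)
Lemma exp_sum_window (es : seq R[i]) (rho : R) (gam : R[i] -> R[i]) (la : R[i]) :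
  uniq es -> 0 < rho -> {in es, forall mu, cmod mu = rho} ->
  la \in es -> gam la != 0 ->
  exists2 del : R, 0 < del & forall i, exists2 t, (t < size es)%N &
    del * rho ^+ (i + t) <= cmod (\sum_(mu <- es) gam mu * mu ^+ (i + t)).
Proof.
move=> es_uniq rho0 es_rho la_es gam0.
pose q := \prod_(mu <- rem la es) ('X - mu%:P).
have szq : size q = size es.
  rewrite /q size_prod_XsubC size_rem // prednK //.
  by case: (es) la_es.
have q_la : q.[la] != 0.
  by rewrite -[_ == 0]/(root q la) root_prod_XsubC mem_rem_uniq // !inE eqxx.
have q_es mu : mu \in es -> mu != la -> q.[mu] = 0.
  move=> mu_es mu_la; apply/eqP; rewrite -[_ == 0]/(root q mu).
  by rewrite root_prod_XsubC mem_rem_uniq // !inE mu_la.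
pose u i := \sum_(mu <- es) gam mu * mu ^+ i.
(* Exchanging the sums turns the coefficients of [q] into the values [q.[mu]], which vanish except
   at [la]. *)
have lagrange i : \sum_(t < size es) q`_t * u (i + t)%N = gam la * q.[la] * la ^+ i.
  transitivity (\sum_(mu <- es) gam mu * q.[mu] * mu ^+ i).
    under eq_bigr do rewrite mulr_sumr.
    rewrite exchange_big; apply: eq_bigr => mu _ /=.
    rewrite horner_coef szq mulr_sumr mulr_suml; apply: eq_bigr => t _.
    by rewrite exprD; ring.
  rewrite (bigD1_seq la) //= big_seq_cond big1 ?addr0 // => mu /andP[mu_es mu_la].
  by rewrite q_es // mulr0 mul0r.
pose S := \sum_(t < size es) cmod q`_t * rho ^+ t.
have S0 : 0 <= S.
  by apply: sumr_ge0 => t _; rewrite mulr_ge0 ?cmod_ge0 // exprn_ge0 // ltW.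
pose G := cmod (gam la * q.[la]).
have G0 : 0 < G by rewrite cmod_gt0 mulf_neq0.
(* The denominator [1 + S] is positive and exceeds [S], so a window of small terms would give
   [G <= G * S / (1 + S) < G]. *)
exists (G / (1 + S)) => [|i]; first by rewrite divr_gt0 // ltr_pwDl.
have [[t t_small]|] := altP (@existsP _ (fun t : 'I_(size es) =>
    G / (1 + S) * rho ^+ (i + t) <= cmod (u (i + t)%N))).
  by exists t.
rewrite negb_exists => /forallP u_small; exfalso.
have : G * rho ^+ i <= G / (1 + S) * S * rho ^+ i.
  rewrite -(es_rho la la_es) -cmodX -cmodM -lagrange.
  apply: le_trans (ler_cmod_sum _ _ _ _ _) _; rewrite cmodX es_rho //.
  rewrite -mulrA mulrC [S * _]mulr_suml mulr_suml ler_sum // => t _.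
  have := u_small t; rewrite -ltNge => /ltW le_u.
  rewrite cmodM; apply: le_trans (ler_wpM2l (cmod_ge0 _ _) le_u) _.
  by rewrite exprD le_eqVlt; apply/orP; left; apply/eqP; ring.
rewrite ler_pM2r ?exprn_gt0 // mulrAC ler_pdivlMr ?ltr_pwDl //.
by rewrite mulrDr mulr1 gerDr leNgt G0.
Qed.

(** This is [g i = O(w i / i)], written without division. *)
Definition negligible (w : nat -> R) (g : nat -> R[i]) : Prop :=
  exists K N, forall i, (N <= i)%N -> cmod (g i) * i%:R <= K * w i.

Lemma negligible0 w : negligible w (fun=> 0).
Proof. by exists 0, 0%N => i _; rewrite cmod0 !mul0r. Qed.

Lemma negligible_eq w f g : (forall i, f i = g i) -> negligible w f -> negligible w g.
Proof. by move=> fg [K [N fK]]; exists K, N => i Ni; rewrite -fg fK. Qed.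

Lemma negligibleD w f g :
  negligible w f -> negligible w g -> negligible w (fun i => f i + g i).
Proof.
move=> [K [N fK]] [L [M gL]]; exists (K + L), (maxn N M) => i.
rewrite geq_max => /andP[Ni Mi].
apply: le_trans (ler_wpM2r (ler0n _ _) (ler_cmodD _ _ _)) _.
by rewrite !mulrDl lerD ?fK ?gL.
Qed.

Lemma negligible_sum w (I : eqType) (r : seq I) (f : I -> nat -> R[i]) :
  {in r, forall x, negligible w (f x)} -> negligible w (fun i => \sum_(x <- r) f x i).
Proof.
elim: r => [|x r IHr] f_neg.
  by apply: negligible_eq (negligible0 w) => i; rewrite big_nil.
apply: (@negligible_eq _ (fun i => f x i + \sum_(y <- r) f y i)).
  by move=> i; rewrite big_cons.
apply: negligibleD; first by apply: f_neg; rewrite mem_head.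
by apply: IHr => y yr; apply: f_neg; rewrite inE yr orbT.
Qed.

Lemma negligible_low_degree (rho : R) (mu c : R[i]) s d :
  0 < rho -> cmod mu = rho -> (s < d)%N ->
  negligible (fun i => 'C(i, d)%:R * rho ^+ i)
             (fun i => 'C(i, s)%:R * mu ^+ (i - s) * c).
Proof.
move=> rho0 mu_rho sd.
exists ((2 * d)%:R * rho ^- s * cmod c), (2 * d)%N => i di.
rewrite !cmodM cmod_nat cmodX mu_rho expfB; last by lia.
have le1 : ('C(i, s) * i)%:R <= (2 * d * 'C(i, d))%:R :> R.
  by rewrite ler_nat bin_mul_index_lt.
have P0 : 0 <= rho ^+ i / rho ^+ s * cmod c.
  by rewrite mulr_ge0 ?cmod_ge0 // divr_ge0 // exprn_ge0 // ltW.
have := ler_wpM2r P0 le1; rewrite !natrM => le2.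
by apply: le_trans (le_trans _ le2) _; rewrite le_eqVlt; apply/orP; left; apply/eqP; ring.
Qed.

(** The ratio [cmod mu / rho] is below 1, so its powers beat ['C(i, s) * i] whatever the order of
    [s] and [d]. *)
Lemma negligible_low_modulus (rho : R) (mu c : R[i]) s d :
  0 < rho -> cmod mu < rho ->
  negligible (fun i => 'C(i, d)%:R * rho ^+ i)
             (fun i => 'C(i, s)%:R * mu ^+ (i - s) * c).
Proof.
move=> rho0 mu_rho.
have [||K geoK] := bin_geometric_decay R (cmod mu / rho) s.
- by rewrite divr_ge0 ?cmod_ge0 // ltW.
- by rewrite ltr_pdivrMr // mul1r.
(* The threshold serves both the decay estimate and the bound [1 <= 'C(i, d)]. *)
exists (K * rho ^- s * cmod c), (2 * s.+1 + d)%N => i di.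
have {}geoK := geoK i (leq_trans (leq_addr _ _) di).
have P0 : 0 <= rho ^+ (i - s) * cmod c.
  by rewrite mulr_ge0 ?cmod_ge0 // exprn_ge0 // ltW.
have rn0 : rho ^+ (i - s) != 0 by rewrite expf_neq0 // gt_eqF.
have le1 := ler_wpM2r P0 geoK.
rewrite !cmodM cmod_nat cmodX.
apply: (@le_trans _ _ (K * (rho ^+ (i - s) * cmod c))).
  apply: le_trans le1; rewrite expr_div_n.
  by rewrite le_eqVlt; apply/orP; left; apply/eqP; field.
have K0 : 0 <= K.
  apply: le_trans geoK; rewrite !mulr_ge0 // exprn_ge0 // divr_ge0 ?cmod_ge0 //.
  exact: ltW.
have C1 : 1 <= 'C(i, d)%:R :> R by rewrite ler1n bin_gt0; lia.
have P1 : 0 <= K * (rho ^+ (i - s) * cmod c) by rewrite mulr_ge0.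
have := ler_wpM2l P1 C1; rewrite mulr1 => /le_trans -> //.
rewrite expfB; last by lia.
by rewrite le_eqVlt; apply/orP; left; apply/eqP; ring.
Qed.

End Asymptotics.

(** The leading part is ['C(i, d)] times an exponential sum over the roots of modulus [rho]; for
    large [i] the remainder costs at most half of the constant given by [exp_sum_window]. *)
Lemma exp_poly_window (R : realType) (es : seq R[i]) (rho : R) (m : nat)
    (c : R[i] -> nat -> R[i]) (a : nat -> R[i]) (la : R[i]) (s0 : nat) :
  uniq es -> 0 < rho -> {in es, forall mu, cmod mu <= rho} ->
  la \in es -> cmod la = rho -> (s0 < m)%N -> c la s0 != 0 ->
  (forall i, a i = \sum_(mu <- es) \sum_(s < m)
                     'C(i, s)%:R * mu ^+ (i - s) * c mu s) ->
  exists2 eta : R, 0 < eta & exists N, forall i, (N <= i)%N ->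
    exists2 t, (t < size [seq mu <- es | cmod mu == rho])%N &
      eta * rho ^+ i <= cmod (a (i + t)%N).
Proof.
move=> es_uniq rho0 es_le la_es la_rho s0m c0 aE.
set per := [seq mu <- es | cmod mu == rho].
have perE mu : (mu \in per) = (cmod mu == rho) && (mu \in es) by rewrite mem_filter.
have per_rho : {in per, forall mu, cmod mu = rho}.
  by move=> mu; rewrite perE => /andP[/eqP].
pose top s := (s < m)%N && has (fun mu => c mu s != 0) per.
have top_ex : exists s, top s.
  exists s0; rewrite /top s0m; apply/hasP; exists la => //.
  by rewrite perE la_rho eqxx.
have top_le s : top s -> (s <= m)%N by case/andP => /ltnW.
case: (ex_maxnP top_ex top_le) => d /andP[dm /hasP[nu nu_per cnu0]] d_max.
(* Dividing by [mu ^+ d] replaces the exponent [i - d] by [i]; roots in [per] are nonzero because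
   [0 < rho]. *)
pose gam mu := c mu d / mu ^+ d.
pose v i := \sum_(mu <- per) gam mu * mu ^+ i.
pose w i : R := 'C(i, d)%:R * rho ^+ i.
pose term mu s i := 'C(i, s)%:R * mu ^+ (i - s) * c mu s.
pose g mu (s : 'I_m) i := if (cmod mu == rho) && (s == d :> nat) then 0 else term mu s i.
have err : negligible R w (fun i => a i - 'C(i, d)%:R * v i).
  apply: (@negligible_eq _ _ (fun i => \sum_(mu <- es) \sum_(s < m) g mu s i)).
    move=> i; apply/eqP; rewrite eq_sym subr_eq; apply/eqP.
    have -> : 'C(i, d)%:R * v i =
        \sum_(mu <- es) \sum_(s < m)
          if (cmod mu == rho) && (s == d :> nat) then term mu s i else 0.
      rewrite /v mulr_sumr big_filter big_mkcond; apply: eq_bigr => mu _ /=.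
      case: eqP => mu_rho /=; last by rewrite big1.
      rewrite -big_mkcond (big_pred1 (Ordinal dm)) //= /term /gam.
      (* For [i < d] the subtraction [i - d] is truncated, but the binomial coefficient is 0 on both
         sides. *)
      have [id|di] := ltnP i d; first by rewrite bin_small // !mul0r.
      have mu0 : mu ^+ d != 0 by rewrite expf_neq0 // -cmod_gt0 mu_rho.
      by rewrite -{2}(subnK di) exprD; field.
    rewrite aE -big_split; apply: eq_bigr => mu _ /=.
    rewrite -big_split; apply: eq_bigr => s _ /=.
    by rewrite /g; case: ifP; rewrite ?add0r ?addr0.
  apply: negligible_sum => mu mu_es; apply: negligible_sum => s _.
  rewrite /g; have [mu_rho|mu_rho] := eqVneq (cmod mu) rho => /=; last first.
    by apply: negligible_low_modulus => //; rewrite lt_neqAle mu_rho es_le.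
  (* On the peripheral roots, orders below [d] lose a factor [i], orders above [d] have zero
     coefficient by maximality of [d], and order [d] was removed from [g]. *)
  case: (ltngtP s d) => [sd|ds|_]; last exact: negligible0.
    exact: negligible_low_degree.
  apply: negligible_eq (negligible0 _ _) => i; rewrite /term.
  suff -> : c mu s = 0 by rewrite mulr0.
  apply/eqP; apply: contraTT ds => cs0; rewrite -leqNgt d_max // /top ltn_ord.
  by apply/hasP; exists mu; rewrite // perE mu_rho eqxx.
have nu_rho := per_rho _ nu_per.
have gam0 : gam nu != 0.
  by rewrite mulf_neq0 // invr_neq0 // expf_neq0 // -cmod_gt0 nu_rho.
have [del del0 win] := exp_sum_window R per rho gam nu (filter_uniq _ es_uniq)
  rho0 per_rho nu_per gam0.
case: err => K [N err].
(* Beyond [M] the relative error [K / j] is at most [del / 2]. *)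
pose M := Num.bound (2 * `|K| / del).
(* A lower bound for [rho ^+ t] over the whole window, whether [rho] is below or above 1; it turns
   [rho ^+ (i + t)] into [rho ^+ i]. *)
pose r1 := Num.min 1 rho ^+ size per.
have r1_gt0 : 0 < r1 by rewrite exprn_gt0 // lt_min ltr01.
exists (del / 2 * r1); first by rewrite mulr_gt0 // divr_gt0.
(* [M.+1] also makes the index positive, and [d] makes the binomial coefficient at least 1. *)
exists (maxn N (maxn M.+1 d)) => i; rewrite !geq_max => /and3P[Ni Mi di].
have [t t_per le_v] := win i; exists t => //.
set j := (i + t)%N in le_v *.
have ij : (i <= j)%N by rewrite leq_addr.
have j0 : 0 < j%:R :> R by rewrite ltr0n (leq_ltn_trans _ (leq_trans Mi ij)).
have Cj : 1 <= 'C(j, d)%:R :> R by rewrite ler1n bin_gt0 (leq_trans di).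
have rj : 0 < rho ^+ j by rewrite exprn_gt0.
have Kj : K <= del / 2 * j%:R.
  have : 2 * `|K| / del < M%:R.
    by apply: archi_boundP; rewrite divr_ge0 ?mulr_ge0 // ltW.
  have : M%:R <= j%:R :> R by rewrite ler_nat (leq_trans (ltnW Mi)).
  rewrite ltr_pdivrMr // => Mj lt1.
  have := ler_norm K; have : M%:R * del <= j%:R * del by rewrite ler_pM2r.
  by lra.
have errj : cmod (a j - 'C(j, d)%:R * v j) <= del / 2 * ('C(j, d)%:R * rho ^+ j).
  rewrite -(ler_pM2r j0); apply: le_trans (err j (leq_trans Ni ij)) _.
  rewrite mulrAC ler_wpM2r //.
  by rewrite mulr_ge0 // ltW.
have le_Cv : cmod ('C(j, d)%:R * v j) <=
    cmod (a j) + cmod (a j - 'C(j, d)%:R * v j).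
  have := ler_cmodD _ (a j) (- (a j - 'C(j, d)%:R * v j)).
  by rewrite cmodN subKr.
have le_aj : del / 2 * rho ^+ j <= cmod (a j).
  rewrite cmodM cmod_nat in le_Cv.
  have := ler_wpM2l (ler0n R 'C(j, d)) le_v; rewrite -/(v j).
  have := ler_wpM2r (mulr_ge0 (ltW del0) (ltW rj)) Cj.
  by move: errj le_Cv; move: (_%:R) (rho ^+ j) (cmod (v j)) => C r cv; lra.
apply: le_trans le_aj.
rewrite -mulrA ler_pM2l ?divr_gt0 // /j exprD mulrC ler_pM2l ?exprn_gt0 //.
have min_ge0 : 0 <= Num.min 1 rho by rewrite le_min ler01 ltW.
apply: (@le_trans _ _ (Num.min 1 rho ^+ t)).
  by rewrite ler_wiXn2l // ?ge_min ?lexx // ltnW.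
by rewrite lerXn2r ?nnegrE ?(ltW rho0) // ge_min lexx orbT.
Qed.

(** * Generalized eigenspaces, matrix powers and controllability *)

Lemma dvdp_prod_XsubC_exp (F : fieldType) (s es : seq F) :
  {subset s <= es} ->
  \prod_(r <- s) ('X - r%:P) %| (\prod_(r <- es) ('X - r%:P)) ^+ size s.
Proof.
elim: s => [|r s IHs] s_es; first by rewrite big_nil dvd1p.
rewrite big_cons exprS dvdp_mul //.
  by rewrite dvdp_XsubCl root_prod_XsubC s_es ?mem_head.
by apply: IHs => x xs; rewrite s_es // inE xs orbT.
Qed.

(** The polynomials [('X - mu%:P) ^+ n.+1] are pairwise coprime and the minimal polynomial divides
    their product, so their kernels at [A] span the space. Splitting the identity along these
    kernels gives the [E mu], whose rows lie in the kernels. *)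
Lemma spectral_decomposition (F : closedFieldType) (n : nat) (A : 'M[F]_n.+1)
    (es : seq F) :
  uniq es -> (forall a, (a \in es) = eigenvalue A a) ->
  exists E : F -> 'M[F]_n.+1,
    \sum_(mu <- es) E mu = 1
    /\ forall mu, E mu * (A - mu%:M) ^+ n.+1 = 0.
Proof.
move=> es_uniq mem_es.
pose p (i : 'I_(size es)) := ('X - (es`_i)%:P) ^+ n.+1.
have cop : {in predT &, forall i j, j != i -> coprimep (p i) (p j)}.
  move=> i j _ _ ij; apply: coprimep_expl; apply: coprimep_expr.
  by rewrite coprimep_XsubC root_XsubC nth_uniq // eq_sym.
have dvdp : mxminpoly A %| \prod_i p i.
  have [s Ds] := closed_field_poly_normal (char_poly A).
  rewrite (monicP (char_poly_monic A)) scale1r in Ds.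
  have s_es r : r \in s -> r \in es.
    by rewrite mem_es eigenvalue_root_char Ds root_prod_XsubC.
  have szs : size s = n.+1.
    by apply: succn_inj; rewrite -(size_prod_XsubC s id) -Ds size_char_poly.
  apply: dvdp_trans (mxminpoly_dvd_char A) _.
  rewrite /p -(big_mkord xpredT (fun i => ('X - (es`_i)%:P) ^+ n.+1)).
  rewrite -(big_nth 0 xpredT (fun r => ('X - r%:P) ^+ n.+1)).
  (* The exponent [n.+1] is the number of roots with multiplicity, hence covers each
     multiplicity. *)
  by rewrite Ds prodrXl -szs dvdp_prod_XsubC_exp.
have : (1%:M <= \sum_i kermxpoly A (p i))%MS.
  by rewrite -(kermxpoly_prod A cop) kermxpoly_min.
case/sub_sumsmxP => u Du.
pose U (i : 'I_(size es)) := u i *m kermxpoly A (p i).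
(* Outside [es] the index is out of range and the value is 0, so the nilpotency relation holds for
   every [mu]. *)
exists (fun mu => if insub (index mu es) is Some i
                  then U i else 0); split.
  rewrite (big_nth 0) big_mkord [RHS]Du.
  by apply: eq_bigr => i _; rewrite index_uniq // valK.
move=> mu; case: insubP => [i | _]; last by rewrite mul0r.
rewrite index_mem => mu_es vali.
rewrite /U -mulmxE -mulmxA /kermxpoly /p vali nth_index //.
have -> : (A - mu%:M) ^+ n.+1 = horner_mx A (('X - mu%:P) ^+ n.+1).
  by rewrite rmorphXn rmorphB /= horner_mx_X horner_mx_C.
by rewrite mulmx_ker mulmx0.
Qed.

Section Powers.
Variables (F : fieldType) (n : nat) (A : 'M[F]_n.+1) (es : seq F).
Variable E : F -> 'M[F]_n.+1.
Hypothesis sumE : \sum_(mu <- es) E mu = 1.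
Hypothesis E_nil : forall mu, E mu * (A - mu%:M) ^+ n.+1 = 0.

(** Binomial expansion of [A = mu%:M + (A - mu%:M)], cut at order [n] by [E_nil]. *)
Lemma generalized_eigenspace_powers mu i :
  E mu * A ^+ i =
  \sum_(s < n.+1) ('C(i, s)%:R * mu ^+ (i - s)) *: (E mu * (A - mu%:M) ^+ s).
Proof.
pose f s := ('C(i, s)%:R * mu ^+ (i - s)) *: (E mu * (A - mu%:M) ^+ s).
have f_ge_n s : (n < s)%N -> f s = 0.
  by move=> ns; rewrite /f -(subnKC ns) exprD mulrA E_nil mul0r scaler0.
have f_gt_i s : (i < s)%N -> f s = 0.
  by move=> /bin_small is0; rewrite /f is0 mul0r scale0r.
transitivity (\sum_(s < i.+1) f s).
  rewrite -{1}[A](subrK mu%:M) addrC exprDn_comm; last first.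
    exact/esym/scalar_mxC.
  rewrite mulr_sumr; apply: eq_bigr => s _.
  rewrite /f scalerAr; congr (_ * _).
  rewrite -rmorphXn /= -scalerA scaler_nat -mul_scalar_mx.
  by rewrite mulmxE.
(* The sums of lengths [i.+1] and [n.+1] are both padded with zeros to the larger length. *)
have widen m k : (m <= k)%N -> (forall s, (m <= s)%N -> f s = 0) ->
    \sum_(s < m) f s = \sum_(s < k) f s.
  move=> mk f0; rewrite (big_ord_widen _ _ mk) big_mkcond.
  by apply: eq_bigr => s _; case: ltnP => // /f0.
by rewrite (widen _ _ (leq_maxl i.+1 n.+1)) // [RHS](widen _ _ (leq_maxr i.+1 n.+1)).
Qed.

(** If [E la] were 0, the product [g] over the other eigenvalues would annihilate [A], since it
    kills every other [E mu]. The minimal polynomial would divide [g], making [la] a root of [g]. *)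
Lemma generalized_projector_neq0 la :
  uniq es -> (forall a, (a \in es) = eigenvalue A a) -> la \in es -> E la != 0.
Proof.
move=> es_uniq mem_es la_es; apply/eqP => Ela0.
pose g := \prod_(mu <- rem la es) ('X - mu%:P) ^+ n.+1.
suff : root g la.
  rewrite /g prodrXl rootE horner_exp expf_eq0 /= -rootE root_prod_XsubC.
  by rewrite mem_rem_uniq // !inE eqxx.
have : horner_mx A g = 0.
  rewrite -[LHS]mul1r -sumE mulr_suml big_seq big1 // => mu mu_es.
  have [->|mu_la] := eqVneq mu la; first by rewrite Ela0 mul0r.
  have mu_rem : mu \in rem la es by rewrite mem_rem_uniq // !inE mu_la.
  rewrite /g (big_rem _ mu_rem) /= rmorphM /= rmorphXn rmorphB /=.
  by rewrite horner_mx_X horner_mx_C mulrA E_nil mul0r.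
move/mxminpoly_min => /dvdpP[q ->].
by rewrite rootM -eigenvalue_root_min -mem_es la_es orbT.
Qed.

Lemma matrix_powers_expansion (B : 'M[F]_n.+1) i :
  A ^+ i *m B = \sum_(mu <- es) \sum_(s < n.+1)
    ('C(i, s)%:R * mu ^+ (i - s)) *: (E mu * (A - mu%:M) ^+ s *m B).
Proof.
rewrite -[A ^+ i]mul1r -sumE mulr_suml mulmx_suml.
apply: eq_bigr => mu _; rewrite generalized_eigenspace_powers mulmx_suml.
by apply: eq_bigr => s _; rewrite scalemxAl.
Qed.

(** If all these coefficients vanished, [E la] would annihilate every [A ^+ i *m B]. The first
    hypothesis is the dual form of controllability. *)
Lemma observable_coefficient_neq0 (B : 'M[F]_n.+1) la :
  (forall M : 'M[F]_n.+1, (forall i, M *m (A ^+ i *m B) = 0) -> M = 0) ->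
  E la != 0 ->
  exists s : 'I_n.+1, E la * (A - la%:M) ^+ s *m B != 0.
Proof.
move=> ctrl Ela; apply/existsP; apply: contraNT Ela.
rewrite negb_exists => /forallP coef0; apply/eqP/ctrl => i.
rewrite mulmxA mulmxE generalized_eigenspace_powers -mulmxE mulmx_suml big1 // => s _.
by rewrite -scalemxAl (eqP (negPn (coef0 s))) scaler0.
Qed.

End Powers.

(** [M] kills each block of the controllability matrix, whose full row rank allows cancellation on
    the right. *)
Lemma controllable_annihilator (R : realType) (z : nat) (Z B : 'M[R[i]]_z) :
  controllable Z B ->
  forall M : 'M[R[i]]_z, (forall i, M *m (Z ^+ i *m B) = 0) -> M = 0.
Proof.
move=> ctrl M MZ0.
have free : row_free (controllability_mx Z B) by apply/eqP.
apply: (row_free_inj free); rewrite mul0mx /controllability_mx mul_mxrow.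
by rewrite -mxrow0; apply/eq_mxrow => k; rewrite MZ0.
Qed.

(** * Peripheral eigenvalues and the entrywise lower bound *)

Lemma cmod_le_spectral_radius (R : realType) (z : nat) (A : 'M[R[i]]_z) (mu : R[i]) :
  mu \in eigenvalues A -> cmod mu <= spectral_radius A.
Proof. by move=> mu_es; apply: le_bigmax_seq. Qed.

Lemma peripheral_eigenvalue_exists (R : realType) (n : nat) (A : 'M[R[i]]_n.+1) :
  exists2 la, la \in eigenvalues A & cmod la = spectral_radius A.
Proof.
have [a a_es] : exists a, a \in eigenvalues A.
  have : size (char_poly A) != 1%N by rewrite size_char_poly.
  by case/closed_rootP => a; rewrite -eigenvalue_root_char -mem_eigenvalues; exists a.
rewrite /spectral_radius; elim: (eigenvalues A) a a_es => // b es IHes a _.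
rewrite big_cons; case: es IHes => [_|c es IHes].
  by exists b; rewrite ?mem_head // big_nil max_l // cmod_ge0.
have [d d_es <-] := IHes c (mem_head _ _).
case: (leP (cmod b) (cmod d)) => _; last by exists b; rewrite ?mem_head.
by exists d; rewrite // inE d_es orbT.
Qed.

(** The annihilator hypothesis covers both a controllable pair and [B = 1], so both parts of the
    theorem follow from it. *)
Lemma entry_lower_bound (R : realType) (n : nat) (Z B : 'M[R[i]]_n.+1) :
  (forall M : 'M[R[i]]_n.+1, (forall i, M *m (Z ^+ i *m B) = 0) -> M = 0) ->
  exists (eta : R) (j k : 'I_n.+1) (l : nat),
    [/\ 0 < eta, (0 < l <= num_peripheral_eigenvalues Z)%N
      & asymp_periodically_lower_bounded
          (fun i => cmod ((Z ^+ i *m B) j k) ^+ 2)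
          (fun i => eta * spectral_radius Z ^+ (2 * i)) l].
Proof.
move=> ctrl; set rho := spectral_radius Z.
have [la la_es la_rho] := peripheral_eigenvalue_exists R n Z.
have p_gt0 : (0 < num_peripheral_eigenvalues Z)%N.
  rewrite /num_peripheral_eigenvalues -has_predT; apply/hasP; exists la => //.
  by rewrite mem_filter la_rho eqxx.
have rho_ge0 : 0 <= rho by rewrite /rho -la_rho cmod_ge0.
(* In the nilpotent case the lower bound is 0 from [i = 1] on; at [i = 0] it would be [eta]. *)
have [rho0|rho_n0] := eqVneq rho 0.
  exists 1, ord0, ord0, 1%N; split=> //; exists 1%N => // i i_gt0.
  by rewrite rho0 expr0n muln_eq0 /= gtn_eqF // mulr0 big_ord_recl le_max sqr_ge0.
have rho_gt0 : 0 < rho by rewrite lt_def rho_n0.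
have es_uniq := eigenvalues_uniq Z.
have mem_es := mem_eigenvalues Z.
have [E [sumE E_nil]] := spectral_decomposition _ _ _ _ es_uniq mem_es.
have Ela0 := generalized_projector_neq0 _ _ _ _ _ sumE E_nil la es_uniq mem_es la_es.
have [s coef0] := observable_coefficient_neq0 _ _ _ _ E_nil B la ctrl Ela0.
pose C mu s := E mu * (Z - mu%:M) ^+ s *m B.
have [j [k Cjk]] : exists j k, C la s j k != 0.
  suff /existsP[j /existsP[k Cjk]] : [exists j, [exists k, C la s j k != 0]].
    by exists j, k.
  apply: contraNT coef0 => /existsPn no_entry; apply/eqP/matrixP => j k.
  by rewrite [RHS]mxE; have /existsPn/(_ k)/negPn/eqP := no_entry j.
have aE i : (Z ^+ i *m B) j k = \sum_(mu <- eigenvalues Z) \sum_(s < n.+1)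
    'C(i, s)%:R * mu ^+ (i - s) * C mu s j k.
  rewrite (matrix_powers_expansion _ _ _ _ _ sumE E_nil) summxE.
  apply: eq_bigr => mu _; rewrite summxE.
  by apply: eq_bigr => r _; rewrite mxE.
have [eta eta0 [N win]] := exp_poly_window R (eigenvalues Z) rho n.+1
  (fun mu s => C mu s j k) _ la s es_uniq rho_gt0
  (fun mu => cmod_le_spectral_radius R _ Z mu) la_es la_rho (ltn_ord s) Cjk aE.
(* The constant is squared because [win] bounds the modulus and not its square. *)
exists (eta ^+ 2), j, k, (num_peripheral_eigenvalues Z); split.
- by rewrite exprn_gt0.
- by rewrite p_gt0 leqnn.
exists N.+1 => // i Ni; have [t t_lt le_t] := win i (ltnW Ni).
apply: (bigmax_sup (Ordinal t_lt)) => //=.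
rewrite mulnC exprM -exprMn lerXn2r ?nnegrE ?cmod_ge0 //.
by rewrite mulr_ge0 ?exprn_ge0 // ltW.
Qed.

Theorem lemma3 (R : realType) (z : nat) (z_gt0 : (0 < z)%N) :
  (forall Z : 'M[R[i]]_z,
     exists (eta : R) (j k : 'I_z) (l : nat),
       [/\ 0 < eta,
           (0 < l <= num_peripheral_eigenvalues Z)%N
         & asymp_periodically_lower_bounded
             (fun i => cmod ((Z ^+ i) j k) ^+ 2)
             (fun i => eta * spectral_radius Z ^+ (2 * i)) l])
  /\
  (forall (Z : 'M[R[i]]_z) (Q sqrtQ : 'M[R]_z),
     sym_psd Q -> is_psd_sqrt Q sqrtQ ->
     controllable Z (complex_mx sqrtQ) ->
     exists (eta : R) (j k : 'I_z) (l : nat),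
       [/\ 0 < eta,
           (0 < l <= num_peripheral_eigenvalues Z)%N
         & asymp_periodically_lower_bounded
             (fun i => cmod ((Z ^+ i *m complex_mx sqrtQ) j k) ^+ 2)
             (fun i => eta * spectral_radius Z ^+ (2 * i)) l]).
Proof.
case: z z_gt0 => // n _; split=> [Z|Z Q S _ _ ctrl].
  have [|eta [j [k [l [eta0 l_le lower]]]]] := entry_lower_bound R n Z 1%:M.
    (* For [B = 1] the exponent 0 alone gives [M = 0]. *)
    by move=> M /(_ 0%N); rewrite expr0 !mulmx1.
  exists eta, j, k, l; split=> //.
  case: lower => N N0 lower; exists N => // i Ni; have := lower i Ni.
  by under eq_bigr do rewrite mulmx1; rewrite mulmx1.
exact/entry_lower_bound/controllable_annihilator.
Qed.
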